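(* Let $\underline{d}=(d_1,\dots,d_n)$ be a sequence of positive integers and let $\underline{b}=(b_1,\dots,b_n)$ be a sequence of arbitrary integers. Then $K_{p,2}^{\underline{d}}(\underline{b})=0$ (as a functor) for $p\leq\min\{d_i+b_i : i=1,\dots,n\}$.
   Context: All vector spaces are finite dimensional over a field $\mathbb{K}$ of characteristic zero; $\mathrm{Vec}$ is the category of such vector spaces. Koszul cohomology: if $X\subset\mathbb{P}W$ is a projective variety embedded by the complete linear series of a line bundle $\mathcal{L}$ (so $W=H^0(X,\mathcal{L})$) and $\mathcal{B}$ is a sheaf on $X$, then $K_{p,q}(X,\mathcal{B};\mathcal{L})$ is the homology at the middle of the Koszul complex $$\bigwedge^{p+1}W\otimes H^0(X,\mathcal{B}\otimes\mathcal{L}^{q-1})\to\bigwedge^{p}W\otimes H^0(X,\mathcal{B}\otimes\mathcal{L}^{q})\to\bigwedge^{p-1}W\otimes H^0(X,\mathcal{B}\otimes\mathcal{L}^{q+1}).$$ $K_{p,q}^{\underline{d}}(\underline{b}):\mathrm{Vec}^n\to\mathrm{Vec}$ is the functor sending $(V_1,\dots,V_n)$ to $K_{p,q}(X,\mathcal{B}_{\underline b};\mathcal{L})$ with $X=\mathbb{P}V_1\times\cdots\times\mathbb{P}V_n$, $\mathcal{L}=\mathcal{O}(d_1,\dots,d_n)$, $\mathcal{B}_{\underline b}=\mathcal{O}(b_1,\dots,b_n)$. The convention for projective space is $H^0(\mathbb{P}V,\mathcal{O}(d))=\mathrm{Sym}^dV$. *)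

(* Defs.v *)
From HB Require Import structures.
From mathcomp Require Import all_boot all_order all_algebra.
From mathcomp Require Import mpoly.

Set Implicit Arguments.
Unset Strict Implicit.
Unset Printing Implicit Defensive.

Import Order.TTheory GRing.Theory Num.Theory.
Local Open Scope ring_scope.

(* ** Sections of line bundles on PV_1 x ... x PV_n                          *)
(* The convention is H^0(PV, O(d)) = Sym^d V, so that                         *)
(*   H^0(PV_1 x ... x PV_n, O(a)) = Sym^(a_1) V_1 (x) ... (x) Sym^(a_n) V_n   *)
(* (and Sym^a V = 0 for a < 0).  A basis of each V_i identifies the symmetric *)
(* algebra of V_1 + ... + V_n with the polynomial ring in the variables       *)
(* x_(i,j), j < \dim V_i, and this tensor product with its subspace of        *)
(* polynomials that are, for each i, homogeneous of degree a_i in the group   *)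
(* of variables x_(i,_).                                                      *)

Section Sections.

Variables (K : fieldType) (n : nat) (V : 'I_n -> vectType K).

Definition svar : finType := {i : 'I_n & 'I_(\dim {:V i})}.

(* {mpoly K[N]} has variables indexed by 'I_N; the variable t : 'I_nsvar is   *)
(* x_(i,j) for (i,j) = enum_val t.                                            *)
Definition nsvar : nat := #|{: svar}|.

Definition multideg (m : 'X_{1..nsvar}) (i : 'I_n) : nat :=
  (\sum_(t < nsvar | tag (enum_val t : svar) == i) m t)%N.

Definition has_multideg (a : 'I_n -> int) : pred 'X_{1..nsvar} :=
  [pred m | [forall i, (multideg m i)%:Z == a i]].

Definition multihomog (a : 'I_n -> int) : {pred {mpoly K[nsvar]}} :=
  [pred p | all (has_multideg a) (msupp p)].

Lemma multihomogP a (p : {mpoly K[nsvar]}) :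
  reflect (forall m, p@_m != 0 -> has_multideg a m) (p \in multihomog a).
Proof.
apply: (iffP allP) => h m; last by rewrite mcoeff_msupp; exact: h.
by rewrite -mcoeff_msupp; exact: h.
Qed.

Fact multihomog_submod_closed a : submod_closed (multihomog a).
Proof.
split=> [|c p q /multihomogP hp /multihomogP hq]; apply/multihomogP => m.
  by rewrite mcoeff0 eqxx.
rewrite mcoeffD mcoeffZ; have [p0|/hp //] := eqVneq p@_m 0.
by rewrite p0 mulr0 add0r => /hq.
Qed.

HB.instance Definition _ a :=
  GRing.isSubmodClosed.Build K {mpoly K[nsvar]} (multihomog a)
    (multihomog_submod_closed a).

Lemma multidegD m1 m2 i :
  multideg (m1 + m2)%MM i = (multideg m1 i + multideg m2 i)%N.
Proof.
by rewrite /multideg -big_split; apply: eq_bigr => t _; rewrite mnmDE.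
Qed.

Lemma mdeg_multideg m : mdeg m = (\sum_i multideg m i)%N.
Proof.
rewrite mdegE /multideg.
by rewrite (partition_big (fun t => tag (enum_val t : svar)) xpredT).
Qed.

Definition sec_bound (a : 'I_n -> int) : nat := (\sum_i `|a i|).+1.

Lemma has_multideg_bound a m : has_multideg a m -> (mdeg m < sec_bound a)%N.
Proof.
move/forallP => hm; rewrite mdeg_multideg ltnS leq_sum // => i _.
by rewrite -(eqP (hm i)).
Qed.

(* The monomials of multidegree a, a basis of H^0(O(a)).                      *)
Record smon (a : 'I_n -> int) := SMon {
  smon_bmnm : 'X_{1..nsvar < sec_bound a};
  _ : has_multideg a smon_bmnm }.

HB.instance Definition _ a := [isSub of smon a for @smon_bmnm a].
HB.instance Definition _ a := [Finite of smon a by <:].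

Definition mon_of_smon a (m : smon a) : 'X_{1..nsvar} := bmnm (smon_bmnm m).

Lemma smon_has_multideg a (m : smon a) : has_multideg a (mon_of_smon m).
Proof. exact: valP m. Qed.

Lemma mon_of_smon_inj a : injective (@mon_of_smon a).
Proof. by move=> m1 m2 eq12; do 2! apply: val_inj. Qed.

Lemma smon_surj a m : has_multideg a m -> exists s : smon a, mon_of_smon s = m.
Proof.
move=> hm; have hb := has_multideg_bound hm.
by exists (@SMon a (BMultinom hb) hm).
Qed.

Record sec (a : 'I_n -> int) := Sec {
  mpoly_of_sec :> {mpoly K[nsvar]};
  _ : mpoly_of_sec \in multihomog a }.

HB.instance Definition _ a := [isSub of sec a for @mpoly_of_sec a].
HB.instance Definition _ a := [Choice of sec a by <:].
HB.instance Definition _ a := [SubChoice_isSubLmodule of sec a by <:].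

Fact mpoly_of_sec_is_linear a : linear (@mpoly_of_sec a).
Proof. by []. Qed.

HB.instance Definition _ a :=
  GRing.isLinear.Build K (sec a) {mpoly K[nsvar]} _ (@mpoly_of_sec a)
    (@mpoly_of_sec_is_linear a).

Lemma sec_multihomog a (f : sec a) : mpoly_of_sec f \in multihomog a.
Proof. exact: valP f. Qed.

Lemma smonX_subproof a (m : smon a) :
  ('X_[mon_of_smon m] : {mpoly K[nsvar]}) \in multihomog a.
Proof.
apply/multihomogP => m'; rewrite mcoeffX; have [<- _|_] := eqVneq (mon_of_smon m) m'.
  exact: smon_has_multideg.
by rewrite eqxx.
Qed.

Definition secX a (m : smon a) : sec a := Sec (smonX_subproof m).

Fact sec_vect_iso a : Vector.axiom #|{: smon a}| (sec a).
Proof.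
pose f (p : sec a) : 'rV[K]_#|{: smon a}| :=
  \row_i (mpoly_of_sec p)@_(mon_of_smon (enum_val i)).
have f_lin : linear f.
  by move=> c p q; apply/rowP => i; rewrite !mxE /= mcoeffD mcoeffZ.
pose g (r : 'rV[K]_#|{: smon a}|) : sec a :=
  \sum_i r 0 i *: secX (enum_val i).
exists f => //; exists g => [p|r].
  apply/val_inj/mpolyP => m; rewrite /g /= !raddf_sum /=.
  have [hm|nhm] := boolP (has_multideg a m); last first.
    transitivity (0 : K); last first.
      by apply/esym/eqP; apply: contraNT nhm; exact/multihomogP/sec_multihomog.
    rewrite big1 // => i _; rewrite mcoeffZ mcoeffX.
    case: eqP => [eq_m|_]; last by rewrite mulr0.
    by rewrite -eq_m smon_has_multideg in nhm.
  have [s <-] := smon_surj hm.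
  rewrite (bigD1 (enum_rank s)) //= big1 ?addr0 => [|i ne_is].
    by rewrite mcoeffZ mcoeffX mxE enum_rankK eqxx mulr1.
  rewrite mcoeffZ mcoeffX; case: eqP => [/mon_of_smon_inj eq_is|_].
    by rewrite -eq_is enum_valK eqxx in ne_is.
  by rewrite mulr0.
apply/rowP => j; rewrite mxE /g !raddf_sum /=.
rewrite (bigD1 j) //= big1 ?addr0 => [|i ne_ij].
  by rewrite mcoeffZ mcoeffX eqxx mulr1.
rewrite mcoeffZ mcoeffX; case: eqP => [/mon_of_smon_inj/enum_val_inj eq_ij|_].
  by rewrite eq_ij eqxx in ne_ij.
by rewrite mulr0.
Qed.

HB.instance Definition _ a := Lmodule_hasFinDim.Build K (sec a) (sec_vect_iso a).

End Sections.

(* ** Koszul complexes                                                        *)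
(* Let W have basis (e_i), i in a finite type I ordered by its enumeration,   *)
(* and let mu i : M -> M' be multiplication by e_i.  Writing                  *)
(* e_S = e_(i_1) /\ ... /\ e_(i_p) for S = {i_1 < ... < i_p}, an element      *)
(* \sum_S e_S (x) c_S of /\W (x) M is the function c : S |-> c_S, and         *)
(*   delta (e_S (x) x)                                                        *)
(*     = \sum_(i in S) (-1)^#{j in S | j < i} e_(S \ i) (x) e_i x.            *)

Section Koszul.

Variables (K : fieldType) (I : finType).

Definition wedge_tensor (M : vectType K) : vectType K := {ffun {set I} -> M}.

Definition wedge_sign (i : I) (S : {set I}) : K :=
  (-1) ^+ #|[set j in S | (enum_rank j < enum_rank i)%N]|.

Section Differential.

Variables (M M' : vectType K) (mu : I -> {linear M -> M'}).

Definition koszul_diff_fun (c : wedge_tensor M) : wedge_tensor M' :=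
  [ffun T : {set I} =>
    \sum_(i | i \notin T) wedge_sign i T *: mu i (c (i |: T))].

Fact koszul_diff_is_linear : linear koszul_diff_fun.
Proof.
move=> a c c'; apply/ffunP => T; rewrite !ffunE scaler_sumr -big_split /=.
apply: eq_bigr => i _; rewrite !ffunE linearP scalerDr !scalerA.
by rewrite [a * _]mulrC.
Qed.

HB.instance Definition _ :=
  GRing.isLinear.Build K (wedge_tensor M) (wedge_tensor M') _ koszul_diff_fun
    koszul_diff_is_linear.

Definition koszul_diff : 'Hom(wedge_tensor M, wedge_tensor M') :=
  linfun koszul_diff_fun.

End Differential.

Lemma wedge_sign_swap (i j : I) (T : {set I}) : i \notin T -> j \notin T ->
  (enum_rank i < enum_rank j)%N ->
  wedge_sign i T * wedge_sign j (i |: T)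
    = - (wedge_sign j T * wedge_sign i (j |: T)).
Proof.
move=> iT jT lt_ij; rewrite /wedge_sign.
have -> : [set k in i |: T | (enum_rank k < enum_rank j)%N]
    = i |: [set k in T | (enum_rank k < enum_rank j)%N].
  by apply/setP => k; rewrite !inE; case: eqP => [->|]; rewrite //= lt_ij.
have -> : [set k in j |: T | (enum_rank k < enum_rank i)%N]
    = [set k in T | (enum_rank k < enum_rank i)%N].
  apply/setP => k; rewrite !inE; case: eqP => [->|] //=.
  by rewrite (negbTE jT) ltnNge ltnW.
by rewrite cardsU1 inE (negbTE iT) /= exprD expr1 mulrCA mulN1r [X in - X]mulrC.
Qed.

Lemma koszul_diff_comp0 (M0 M1 M2 : vectType K)
    (mu0 : I -> {linear M0 -> M1}) (mu1 : I -> {linear M1 -> M2}) :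
  (forall i j x, mu1 i (mu0 j x) = mu1 j (mu0 i x)) ->
  (koszul_diff mu1 \o koszul_diff mu0)%VF = 0.
Proof.
move=> mu_comm; apply/lfunP => c; rewrite comp_lfunE /koszul_diff !lfunE /=.
apply/ffunP => T; rewrite !ffunE.
pose F i j : M2 := (wedge_sign i T * wedge_sign j (i |: T))
  *: mu1 i (mu0 j (c (j |: (i |: T)))).
pose P i j := [&& i \notin T, j \notin T & (enum_rank i < enum_rank j)%N].
transitivity (\sum_i \sum_(j | P i j) F i j + \sum_i \sum_(j | P j i) F i j).
  rewrite -big_split big_mkcond; apply: eq_bigr => i _ /=.
  rewrite /P; case: (i \in T) => /=.
    by rewrite !big_pred0 ?addr0 // => j; rewrite ?andbF.
  rewrite ffunE linear_sum scaler_sumr.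
  rewrite (bigID (fun j => (enum_rank i < enum_rank j)%N)) /=; congr (_ + _).
    apply: eq_big => [j|j _]; last by rewrite linearZ scalerA.
    rewrite in_setU1 negb_or; case: eqP => [->|_] //=.
    by rewrite ltnn andbF.
  apply: eq_big => [j|j _]; last by rewrite linearZ scalerA.
  rewrite in_setU1 negb_or -leqNgt ltn_neqAle.
  rewrite (inj_eq val_inj) (inj_eq enum_rank_inj).
  by case: (j == i); rewrite ?andbF ?andbT.
rewrite [X in _ + X](exchange_big_dep xpredT) //= -big_split big1 // => i _.
rewrite -big_split big1 // => j /and3P[iT jT lt_ij].
rewrite /F (wedge_sign_swap iT jT lt_ij) (mu_comm i j) [j |: (i |: T)]setUCA.
by rewrite scaleNr; apply: addNr.
Qed.

Definition off_degree (M : vectType K) (p : nat) (c : wedge_tensor M) :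
    wedge_tensor M :=
  [ffun S : {set I} => if #|S| == p then 0 else c S].

Fact off_degree_is_linear M p : linear (@off_degree M p).
Proof.
move=> a c c'; apply/ffunP => S; rewrite !ffunE.
by case: ifP; rewrite ?scaler0 ?addr0.
Qed.

HB.instance Definition _ M p :=
  GRing.isLinear.Build K (wedge_tensor M) (wedge_tensor M) _ (@off_degree M p)
    (@off_degree_is_linear M p).

(* /\^p W (x) M, the elements supported on the S of cardinality p.            *)
Definition wedge_pow (M : vectType K) (p : nat) : {vspace wedge_tensor M} :=
  lker (linfun (@off_degree M p)).

Lemma wedge_powP (M : vectType K) p (c : wedge_tensor M) :
  reflect (forall S, c S != 0 -> #|S| = p) (c \in wedge_pow M p).
Proof.
rewrite memv_ker lfunE /=; apply: (iffP eqP) => [c0 S|h].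
  have /ffunP/(_ S) := c0; rewrite !ffunE.
  by case: eqP => // _ ->; rewrite eqxx.
apply/ffunP => S; rewrite !ffunE; case: eqP => // /eqP neS.
by apply/eqP; apply: contraNT neS => /h/eqP.
Qed.

(* The homology at the middle of                                              *)
(*   /\^(p+1) W (x) M0 -> /\^p W (x) M1 -> /\^(p-1) W (x) M2,                 *)
(* the quotient ker / im being represented by a complement of im in ker; for  *)
(* p = 0 the last term is 0.                                                  *)
Definition koszul_homology (M0 M1 M2 : vectType K)
    (mu0 : I -> {linear M0 -> M1}) (mu1 : I -> {linear M1 -> M2}) (p : nat) :
    {vspace wedge_tensor M1} :=
  ((lker (koszul_diff mu1) :&: wedge_pow M1 p)
     :\: (koszul_diff mu0 @: wedge_pow M0 p.+1))%VS.

Lemma koszul_homology_eq0 (M0 M1 M2 : vectType K)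
    (mu0 : I -> {linear M0 -> M1}) (mu1 : I -> {linear M1 -> M2}) (p : nat) :
  (koszul_homology mu0 mu1 p == 0%VS)
    = (lker (koszul_diff mu1) :&: wedge_pow M1 p
         <= koszul_diff mu0 @: wedge_pow M0 p.+1)%VS.
Proof. exact: diffv_eq0. Qed.

End Koszul.

(* ** The functors K_(p,q)^d(b)                                               *)

Section KoszulFunctor.

Variables (K : fieldType) (n : nat) (d : 'I_n -> nat) (b : 'I_n -> int).

(* The degree of B (x) L^q.                                                   *)
Definition twist (q : int) : 'I_n -> int := fun i => b i + q * (d i)%:Z.

Section Object.

Variable V : 'I_n -> vectType K.

(* The basis of W = H^0(L) used in the Koszul complex.                        *)
Definition Lmon : finType := smon V (fun i => (d i)%:Z).

Lemma Lmul_subproof q q' (hq : q' = q + 1) (m : Lmon) (f : sec V (twist q)) :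
  'X_[mon_of_smon m] * mpoly_of_sec f \in multihomog (twist q').
Proof.
apply/multihomogP => m'; rewrite mulrC -mcoeff_msupp => /msuppM_le/allpairsP[].
case=> m1 m2 /= []; rewrite msuppX inE mcoeff_msupp => h1 /eqP -> ->.
have /multihomogP/(_ _ h1)/forallP h1i := sec_multihomog f.
have /forallP h2i := smon_has_multideg m.
apply/forallP => i; rewrite multidegD PoszD (eqP (h1i i)) (eqP (h2i i)).
by rewrite hq /twist mulrDl mul1r addrA.
Qed.

(* Multiplication by a monomial section of L,                                 *)
(* H^0(B (x) L^q) -> H^0(B (x) L^(q+1)).                                      *)
Definition Lmul q q' (hq : q' = q + 1) (m : Lmon) (f : sec V (twist q)) :
    sec V (twist q') :=
  Sec (Lmul_subproof hq m f).

Fact Lmul_is_linear q q' (hq : q' = q + 1) m : linear (Lmul hq m).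
Proof. by move=> c f g; apply: val_inj; rewrite /= mulrDr -scalerAr. Qed.

HB.instance Definition _ q q' (hq : q' = q + 1) m :=
  GRing.isLinear.Build K (sec V (twist q)) (sec V (twist q')) _
    (Lmul hq m) (Lmul_is_linear hq m).

Lemma Lmul_comm q q' q'' (h : q' = q + 1) (h' : q'' = q' + 1) m1 m2 f :
  Lmul h' m1 (Lmul h m2 f) = Lmul h' m2 (Lmul h m1 f).
Proof. by apply: val_inj; rewrite /= mulrCA. Qed.

(* K_(p,q)(X, B; L)                                                           *)
Definition koszul_cohomology (p : nat) (q : int) :
    {vspace wedge_tensor Lmon (sec V (twist q))} :=
  koszul_homology
    (fun m => Lmul (esym (subrK 1 q)) m : {linear _ -> _})
    (fun m => Lmul (erefl (q + 1)) m : {linear _ -> _}) p.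

End Object.

(* The object part of K_(p,q)^d(b) : Vec^n -> Vec.                            *)
Definition koszul_functor (p : nat) (q : int) (V : 'I_n -> vectType K) :
    vectType K :=
  subvs_of (koszul_cohomology V p q).

End KoszulFunctor.

(* Main.v *)
Require Import Defs.
From mathcomp Require Import all_boot all_order all_algebra.
From mathcomp Require Import mpoly zify.
Import Order.TTheory GRing.Theory Num.Theory.
Local Open Scope ring_scope.

(* In the fine grading by monomials x^alpha the Koszul complex is the chain   *)
(* complex of the simplicial complex D(alpha) of the sets of monomials of     *)
(* multidegree d whose product divides x^alpha, and K_(p,2) is its homology   *)
(* at the sets of cardinality p, where deg_i alpha = b_i + (p + 2) d_i, which *)
(* is at least (p + 1) d_i + p for all i.                                     *)
(*   By induction on p: by Mayer-Vietoris and the vanishing for p - 1         *)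
(* (applied to alpha / (x_k x_l)), a cycle of D(alpha) is a sum of cycles of  *)
(* the D(alpha / x_k), x_k ranging over the i-th group of variables.          *)
(* Iterating, it is a sum of cycles of complexes D(alpha / m) with m of       *)
(* multidegree d, and in D(alpha) the latter bound cones with apex m.         *)

Set Implicit Arguments.
Unset Strict Implicit.
Unset Printing Implicit Defensive.

(** The hypothesis p <= d_i + b_i says exactly that deg_i alpha >= (p + 1) d_i + p, and this degree
    is spent as a budget: the faces of a cycle on p-element sets use p d_i, a cone apex uses d_i
    more, and the remaining p pays, one unit per drop in p, for the variables divided out on
    Mayer-Vietoris intersections. [boundary_cone] contracts the cones, [split_cycles] decomposes the
    cycles, and [fills_divides] combines both into the vanishing for one alpha.
    [koszul_cohomology2_eq0] glues the fillings over all alpha by [slice] and [assemble]. *)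

(** * Simplicial chains with scalar coefficients, supports and cones *)

Section Chains.

Variables (K : fieldType) (I : finType).

Local Notation chain := (wedge_tensor I K^o).
Local Notation sign := (wedge_sign K).

Implicit Types (c z : chain) (F : pred {set I}) (S T : {set I}).

Definition boundary : 'Hom(chain, chain) :=
  koszul_diff (fun _ : I => idfun : {linear K^o -> K^o}).

Lemma boundaryE c T :
  boundary c T = \sum_(i | i \notin T) sign i T * c (i |: T) :> K.
Proof. by rewrite /boundary /koszul_diff lfunE /= ffunE. Qed.

Lemma boundary_boundary c : boundary (boundary c) = 0.
Proof.
have /lfunP/(_ c) := @koszul_diff_comp0 K I K^o K^o K^o
  (fun _ => idfun : {linear _ -> _}) (fun _ => idfun : {linear _ -> _})
  (fun _ _ _ => erefl).
by rewrite comp_lfunE zero_lfunE.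
Qed.

Definition supported F c : bool := [forall S, (c S != 0) ==> F S].

Lemma supportedP F c : reflect (forall S, c S != 0 -> F S) (supported F c).
Proof. by apply: (iffP forallP) => h S; apply/implyP/h. Qed.

Lemma supported0 F : supported F 0.
Proof. by apply/supportedP => S; rewrite ffunE eqxx. Qed.

Lemma supportedD F c1 c2 :
  supported F c1 -> supported F c2 -> supported F (c1 + c2).
Proof.
move=> /supportedP h1 /supportedP h2; apply/supportedP => S; rewrite ffunE.
by have [-> /[!add0r]/h2|/h1] := eqVneq (c1 S) 0.
Qed.

Lemma supportedN F c : supported F c -> supported F (- c).
Proof.
by move=> /supportedP h; apply/supportedP => S; rewrite ffunE oppr_eq0 => /h.
Qed.

Lemma sub_supported F F' c : subpred F F' -> supported F c -> supported F' c.
Proof. by move=> sFF' /supportedP h; apply/supportedP => S /h/sFF'. Qed.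

(** Indexing is by cardinality, not dimension: [p = 0] is the empty face, so the complex is
    augmented. *)
Definition faces (p : nat) F : pred {set I} :=
  fun S => (#|S| == p) && F S.

Definition simplicial F := forall i S, F (i |: S) -> F S.

Lemma supported_boundary p F c : simplicial F ->
  supported (faces p.+1 F) c -> supported (faces p F) (boundary c).
Proof.
move=> simF /supportedP hc; apply/supportedP => T; apply: contraNT => nT.
rewrite boundaryE big1 // => i iT.
apply/eqP; rewrite mulf_eq0; apply/orP; right; apply: contraNT nT.
move=> /hc /andP[]; rewrite /faces cardsU1 iT add1n eqSS => -> /=.
exact: simF.
Qed.

Lemma boundary_supp0 F c : supported (faces 0 F) c -> boundary c = 0.
Proof.
move=> /supportedP hc; apply/ffunP => T; rewrite [LHS]boundaryE ffunE.
apply: big1 => i iT; apply/eqP; rewrite mulf_eq0; apply/orP; right.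
by apply: contraTT isT => /hc; rewrite /faces cardsU1 iT.
Qed.

Definition restrict F c : chain := [ffun S => if F S then c S else 0].

Lemma supported_restrict p F F' c :
  supported (faces p F') c -> supported (faces p F) (restrict F c).
Proof.
move=> /supportedP hc; apply/supportedP => S; rewrite ffunE.
by case: ifP => [FS /hc /andP[pS _]|]; rewrite /faces ?FS ?pS ?eqxx.
Qed.

Lemma supported_restrictC p F F1 F2 c :
    (forall S, F S -> F1 S || F2 S) -> supported (faces p F) c ->
  supported (faces p F2) (c - restrict F1 c).
Proof.
move=> sF /supportedP hc; apply/supportedP => S; rewrite !ffunE.
case: ifPn => [_|nF1]; first by rewrite subrr eqxx.
by rewrite subr0 => /hc /andP[pS /sF]; rewrite /faces pS (negPf nF1).
Qed.

(* [cone v c] is [e_v /\ c].                                                  *)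
Definition cone v c : chain :=
  [ffun S : {set I} => if v \in S then sign v (S :\ v) * c (S :\ v) else 0].

Lemma sqr_wedge_sign v S : sign v S * sign v S = 1.
Proof. by rewrite /wedge_sign -expr2 sqrr_sign. Qed.

(** Only the sign of the larger of [v] and [i] sees the element added to [T], so exactly one factor
    flips. *)
Lemma wedge_sign_exchange v i T : v \notin T -> i \notin T -> v != i ->
  sign i (v |: T) * sign v (i |: T) = - (sign v T * sign i T).
Proof.
have main (u w : I) (U : {set I}) : u \notin U -> w \notin U ->
    (enum_rank u < enum_rank w)%N ->
    sign w (u |: U) * sign u (w |: U) = - (sign u U * sign w U).
  move=> uU wU lt_uw; have E := wedge_sign_swap K uU wU lt_uw.
  rewrite -[LHS]mul1r -(sqr_wedge_sign u U) -mulrA [X in _ * X]mulrA E.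
  rewrite mulNr mulrN -[sign w U * _ * _]mulrA.
  by rewrite sqr_wedge_sign mulr1.
move=> vT iT ne_vi; have [lt|gt|/val_inj/enum_rank_inj eq_vi] :=
  ltngtP (enum_rank v) (enum_rank i).
- exact: main.
- by rewrite mulrC main // mulrC.
- by rewrite eq_vi eqxx in ne_vi.
Qed.

(** Wedging with e_v is a contracting homotopy of the full complex. *)
Lemma boundary_cone v c : boundary (cone v c) + cone v (boundary c) = c.
Proof.
apply/ffunP => T; rewrite !ffunE [X in X + _](boundaryE _ T).
have [vT|vT] := boolP (v \in T); last first.
  rewrite addr0 (bigD1 v) //= big1 ?addr0 => [|i /andP[iT ne_iv]].
    by rewrite ffunE setU11 setU1K // mulrA sqr_wedge_sign mul1r.
  by rewrite ffunE in_setU1 eq_sym (negPf ne_iv) (negPf vT) mulr0.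
have vTv : v \notin T :\ v by rewrite !inE eqxx.
(* The term [i = v] gives [c T]; all others cancel against the boundary of the cone. *)
rewrite boundaryE (bigD1 v vTv) /= mulrDr mulrA sqr_wedge_sign mul1r setD1K //.
rewrite addrCA -[RHS]addr0; congr (_ + _).
rewrite mulr_sumr -[X in _ + X]opprK -sumrN.
apply/eqP; rewrite subr_eq0; apply/eqP.
apply: eq_big => [i|i iT].
  by rewrite !inE; case: eqP => [->|]; rewrite ?vT ?andbT.
have ne_vi : v != i by apply: contraNneq iT => <-.
have iTv : i \notin T :\ v by rewrite !inE negb_and iT orbT.
rewrite ffunE in_setU1 vT orbT.
have -> : (i |: T) :\ v = i |: (T :\ v).
  apply/setP => j; rewrite !inE.
  by case: (eqVneq j v) => [->|]; rewrite ?(negPf ne_vi).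
rewrite -{1}(setD1K vT) !mulrA wedge_sign_exchange //.
by rewrite mulNr.
Qed.

Lemma boundary_cone_cycle v z : boundary z = 0 -> boundary (cone v z) = z.
Proof.
move=> bz; rewrite -[RHS](boundary_cone v) bz -[LHS]addr0; congr (_ + _).
by apply/ffunP => S; rewrite !ffunE mulr0 if_same.
Qed.

End Chains.

Arguments boundary {K I}.

(** * Acyclicity of the divisor complexes D(alpha / x^g) *)

Section Divisors.

Variables (K : fieldType) (n : nat) (V : 'I_n -> vectType K) (d : 'I_n -> nat).

Local Notation I := (Lmon d V).
Local Notation N := (nsvar V).
Local Notation mon := (@mon_of_smon K n V (fun i => (d i)%:Z)).
Local Notation grp k := (tag (enum_val k : svar V)).
Local Notation chain := (wedge_tensor I K^o).

Implicit Types (g m : 'X_{1..N}) (S : {set I}) (z f : chain).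

Definition weight S : 'X_{1..N} := (\sum_(v in S) mon v)%MM.

Lemma weightU1 v S : v \notin S -> weight (v |: S) = (mon v + weight S)%MM.
Proof. by move=> vS; rewrite /weight big_setU1. Qed.

Lemma multideg0 i : multideg (0%MM : 'X_{1..N}) i = 0%N.
Proof. by rewrite /multideg big1 // => t _; rewrite mnm0E. Qed.

Lemma multideg_mnm1 k i : multideg (U_(k)%MM : 'X_{1..N}) i = (grp k == i).
Proof.
rewrite /multideg big_mkcond (bigD1 k) //= mnm1E eqxx big1 => [|t ne_tk].
  by case: ifP; rewrite ?addn0.
by rewrite mnm1E [k == t]eq_sym (negPf ne_tk) if_same.
Qed.

Lemma multideg_mon (v : I) i : multideg (mon v) i = d i.
Proof. by have /forallP/(_ i)/eqP[] := smon_has_multideg v. Qed.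

Lemma multideg_weight S i : multideg (weight S) i = (#|S| * d i)%N.
Proof.
rewrite /weight -sum_nat_const.
rewrite (big_morph (fun m : 'X_{1..N} => multideg m i)
  (fun m1 m2 => multidegD m1 m2 i) (multideg0 i)).
by apply: eq_bigr => v _; rewrite multideg_mon.
Qed.

Variable alpha : 'X_{1..N}.

(* D(x^alpha / x^g), empty when x^g does not divide x^alpha.                  *)
Definition divides g : pred {set I} := fun S => (g + weight S <= alpha)%MM.

Lemma simplicial_divides g : simplicial (divides g).
Proof.
move=> v S; have [vS|vS] := boolP (v \in S).
  by rewrite (setUidPr _) // sub1set.
apply: lepm_trans; apply/mnm_lepP => t.
by rewrite weightU1 // !mnmDE leq_add2l leq_addl.
Qed.

Lemma dividesDl g m : subpred (divides (g + m)) (divides g).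
Proof.
move=> S; apply: lepm_trans; apply/mnm_lepP => t.
by rewrite !mnmDE leq_add2r leq_addr.
Qed.

(** Otherwise x^g times the weight of [S] would exhaust alpha in every variable of group [i],
    against the degree count. *)
Lemma dividesD1 g S i : divides g S ->
    (multideg g i + #|S| * d i < multideg alpha i)%N ->
  exists2 k, grp k = i & divides (g + U_(k)) S.
Proof.
move=> /mnm_lepP gS lt_deg.
have [/existsP[k /andP[/eqP ki lt_k]]|] := boolP [exists k : 'I_N,
    (grp k == i) && ((g + weight S)%MM k < alpha k)%N].
  exists k => //; apply/mnm_lepP => t; move: (gS t) lt_k; rewrite !mnmDE mnm1E.
  by case: eqP => [->|_]; lia.
move/existsPn => max_k; move: lt_deg; rewrite ltnNge => /negP[].
rewrite -multideg_weight -multidegD; apply: leq_sum => k ki.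
by have := max_k k; rewrite ki /= -leqNgt.
Qed.

Definition fills p F := forall z, supported (faces p F) z -> boundary z = 0 ->
  exists2 f, supported (faces p.+1 F) f & boundary f = z.

Definition divides_some g (R : seq 'I_N) : pred {set I} :=
  fun S => has (fun k => divides (g + U_(k)) S) R.

Lemma simplicial_divides_some g R : simplicial (divides_some g R).
Proof.
move=> v S /hasP[k kR /simplicial_divides kS].
by apply/hasP; exists k.
Qed.

(* Mayer-Vietoris: if the boundary of [b] is also that of a chain [y] on the  *)
(* intersection, then [a + b = (a + y) + (b - y)] splits the cycle [a + b]    *)
(* into cycles.  Quantifying over additive predicates [Q] expresses being a   *)
(* sum of cycles on the pieces.                                               *)
Lemma split_cycles_step p i g (R : seq 'I_N) (Q : chain -> Prop) :
    (forall r (R' : seq 'I_N) (a b : chain), uniq (r :: R') ->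
      {in r :: R', forall k, grp k = i} ->
      supported (faces p (divides_some g R')) a ->
      supported (faces p (divides (g + U_(r)))) b ->
      boundary (a + b) = 0 ->
      exists y, [/\ supported (faces p (divides_some g R')) y,
                    supported (faces p (divides (g + U_(r)))) y
                  & boundary y = boundary b]) ->
    uniq R -> {in R, forall k, grp k = i} ->
    Q 0 -> (forall z1 z2, Q z1 -> Q z2 -> Q (z1 + z2)) ->
    (forall k z, k \in R -> supported (faces p (divides (g + U_(k)))) z ->
      boundary z = 0 -> Q z) ->
  forall z, supported (faces p (divides_some g R)) z -> boundary z = 0 -> Q z.
Proof.
move=> connect uR Ri Q0 QD.
elim: R uR Ri => [_ _ _ z /supportedP hz _|r R IHR uR Ri Qk z hz bz].
  suff -> : z = 0 by [].
  by apply/ffunP => S; rewrite ffunE; apply/eqP/negPn/negP => /hz /andP[].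
set B := divides (g + U_(r)).
have supp_b : supported (faces p B) (restrict B z) := supported_restrict B hz.
have supp_a : supported (faces p (divides_some g R)) (z - restrict B z).
  by apply: supported_restrictC hz.
have [|y [supp_Ay supp_By eq_y]] := connect r R _ _ uR Ri supp_a supp_b.
  by rewrite subrK.
have -> : z = (z - restrict B z + y) + (restrict B z - y).
  by rewrite -addrA [y + _]addrC !subrK.
apply: QD; last first.
  apply: (Qk r); rewrite ?mem_head //.
    by apply: supportedD => //; apply: supportedN.
  by rewrite linearB /= eq_y subrr.
have /andP[_ uR'] := uR; apply: IHR => //.
- by move=> k kR; apply: Ri; rewrite in_cons kR orbT.
- by move=> k y' kR; apply: Qk; rewrite in_cons kR orbT.
- exact: supportedD.
by rewrite linearD linearB /= bz eq_y sub0r addNr.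
Qed.

(** The common boundary in a Mayer-Vietoris step lives on sets one smaller, in an intersection that
    is again a union, of the D(alpha / (x^g x_r x_k)). Induction on [p] splits it, and [fills]
    bounds its pieces. The term [(i == j)] reserves room for x_k. *)
Lemma split_cycles p i g (R : seq 'I_N) (Q : chain -> Prop) :
    (forall q g', (q < p)%N ->
      (forall j, (multideg g' j + q.+1 * d j + q <= multideg alpha j)%N) ->
      fills q (divides g')) ->
    (forall j, (multideg g j + p * d j + p + (i == j) <= multideg alpha j)%N) ->
    uniq R -> {in R, forall k, grp k = i} ->
    Q 0 -> (forall z1 z2, Q z1 -> Q z2 -> Q (z1 + z2)) ->
    (forall k z, k \in R -> supported (faces p (divides (g + U_(k)))) z ->
      boundary z = 0 -> Q z) ->
  forall z, supported (faces p (divides_some g R)) z -> boundary z = 0 -> Q z.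
Proof.
elim: p => [|p IHp] in g R Q *.
  move=> _ _; apply: split_cycles_step => r R' a b _ _ _ supp_b _.
  by exists 0; rewrite !supported0 linear0 (boundary_supp0 supp_b).
move=> fill deg_alpha.
apply: split_cycles_step => r R' a b /= /andP[rR' uR'] Ri supp_a supp_b bab.
have eq_b : boundary b = - boundary a.
  by apply/eqP; move/eqP: bab; rewrite linearD addrC addr_eq0.
have ri : grp r = i by apply: Ri; rewrite mem_head.
have R'i : {in R', forall k, grp k = i}.
  by move=> k kR'; apply: Ri; rewrite in_cons kR' orbT.
(* [Q'] says that [w] bounds inside the intersection; it is additive, so it can be checked on
   pieces. *)
pose Q' (w : chain) := exists y : chain,
  [/\ supported (faces p.+1 (divides_some g R')) y,
      supported (faces p.+1 (divides (g + U_(r)))) y & boundary y = w].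
have supp_ba := supported_boundary (@simplicial_divides_some g R') supp_a.
have supp_bb := supported_boundary (@simplicial_divides (g + U_(r))) supp_b.
apply: (IHp (g + U_(r))%MM R' Q') => //.
- by move=> q g' lt_qp; apply: fill; apply: leqW.
- by move=> j; rewrite multidegD multideg_mnm1 ri; have := deg_alpha j; lia.
- by exists 0; rewrite !supported0 linear0.
- move=> _ _ [y1 [A1 B1 <-]] [y2 [A2 B2 <-]]; exists (y1 + y2).
  by rewrite !supportedD ?linearD.
- move=> k z kR' supp_z bz.
  (* In group [i], the drop from [p.+1] to [p] pays for x_r and [(i == j)] for x_k. *)
  have deg_k j : (multideg (g + U_(r) + U_(k)) j + p.+1 * d j + p
      <= multideg alpha j)%N.
    rewrite !multidegD !multideg_mnm1 ri (R'i _ kR').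
    by have := deg_alpha j; case: (i == j); nia.
  have [y supp_y eq_y] := fill p _ (ltnSn p) deg_k z supp_z bz.
  exists y; split=> //.
    apply: sub_supported supp_y => S /andP[pS kS]; rewrite /faces pS.
    apply/hasP; exists k => //; apply: (@dividesDl _ U_(r)).
    by rewrite -addmA [(U_(k) + _)%MM]addmC addmA.
  apply: sub_supported supp_y => S /andP[pS kS].
  by rewrite /faces pS (dividesDl kS).
(* Since x_r and x_k are distinct variables, room for each separately is room for their product. *)
- apply/supportedP => S bS; have /andP[pS rS] := supportedP _ _ supp_bb S bS.
  have : supported (faces p (divides_some g R')) (boundary b).
    by rewrite eq_b supportedN.
  move=> /supportedP/(_ S bS)/andP[_ /hasP[k kR' kS]].
  rewrite /faces pS; apply/hasP; exists k => //; apply/mnm_lepP => t.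
  move: (mnm_lepP rS t) (mnm_lepP kS t); rewrite !mnmDE !mnm1E.
  have ne_rk : r != k by apply: contraNneq rR' => ->.
  by case: (eqVneq r t) => [<-|_]; rewrite ?[k == r]eq_sym ?(negPf ne_rk); lia.
- exact: boundary_boundary.
Qed.

Lemma supported_cone p g (v : I) z :
  supported (faces p (divides (g + mon v))) z ->
  supported (faces p.+1 (divides g)) (cone v z).
Proof.
move=> /supportedP hz; apply/supportedP => S; rewrite ffunE.
case: ifP => [vS|]; last by rewrite eqxx.
rewrite mulf_eq0 negb_or => /andP[_ /hz/andP[/eqP pS vSv]].
rewrite /faces (cardsD1 v) vS pS eqxx /=; move: vSv; rewrite /divides.
by rewrite -addmA -weightU1 ?setD1K // !inE eqxx.
Qed.

Lemma fills_divides p g :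
  (forall j, (multideg g j + p.+1 * d j + p <= multideg alpha j)%N) ->
  fills p (divides g).
Proof.
elim/ltn_ind: p g => p IHp g deg_alpha.
(* [m] grows from 1 to a monomial of multidegree [d], and [e] bounds the degree still missing. *)
suff descend e m : (\sum_i (d i - multideg m i) <= e)%N ->
    (forall i, (multideg m i <= d i)%N) ->
    forall z, supported (faces p (divides (g + m))) z -> boundary z = 0 ->
    exists2 f, supported (faces p.+1 (divides g)) f & boundary f = z.
  move=> z supp_z; apply: (descend _ 0%MM (leqnn _)); last by rewrite addm0.
  by move=> i; rewrite multideg0.
elim: e m => [|e IHe] m le_e le_m z supp_z bz.
  have deg_m : has_multideg (fun i => (d i)%:Z) m.
    apply/forallP => i; apply/eqP; congr Posz; apply/eqP.
    rewrite eqn_leq le_m -subn_eq0 -leqn0 (leq_trans _ le_e) //.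
    by rewrite (bigD1 i) //= leq_addr.
  (* Now [m] is a vertex [v], and coning with it turns the divisor [m] into a factor of the face
     weights. *)
  have [v eq_v] := smon_surj deg_m.
  exists (cone v z); first by apply: supported_cone; rewrite eq_v.
  exact: boundary_cone_cycle.
have [/forallP full|/forallPn[i]] := boolP [forall i, d i <= multideg m i]%N.
  apply: (IHe m) => //; rewrite big1 // => i _; apply/eqP.
  by rewrite subn_eq0 full.
rewrite -ltnNge => lt_i.
pose R := [seq k <- enum 'I_N | grp k == i].
pose Q (w : chain) := exists2 f : chain,
  supported (faces p.+1 (divides g)) f & boundary f = w.
have inR k : (k \in R) = (grp k == i) by rewrite mem_filter mem_enum andbT.
apply: (@split_cycles p i (g + m)%MM R Q) => //.
- by move=> q g' lt_qp; apply: IHp.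
(* [m] spends the d_j kept for the apex; the strict inequality at [i] leaves the unit for x_k. *)
- move=> j; rewrite multidegD; have := deg_alpha j; have := le_m j.
  by case: eqP => [<-|_]; nia.
- by rewrite filter_uniq ?enum_uniq.
- by move=> k; rewrite inR => /eqP.
- by exists 0; rewrite ?supported0 ?linear0.
- move=> _ _ [f1 supp1 <-] [f2 supp2 <-]; exists (f1 + f2).
    exact: supportedD.
  by rewrite linearD.
- move=> k w; rewrite inR => /eqP ki supp_w bw.
  apply: (IHe (m + U_(k))%MM) => //; last by rewrite addmA.
    rewrite (bigD1 i) //= multidegD multideg_mnm1 ki eqxx addn1.
    move: le_e; rewrite (bigD1 i) //= => le_e.
    rewrite -ltnS (leq_trans _ le_e) // -addSn leq_add //; first by lia.
    by apply: leq_sum => j ne_ji; rewrite multidegD; lia.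
  by move=> j; rewrite multidegD multideg_mnm1 ki; have := le_m j;
    case: eqP => [<-|_]; lia.
apply/supportedP => S zS; have /andP[pS mS] := supportedP _ _ supp_z S zS.
have [|k ki kS] := @dividesD1 (g + m)%MM S i mS.
  by rewrite (eqP pS) multidegD; have := deg_alpha i; nia.
by rewrite /faces pS; apply/hasP; exists k => //; rewrite inR ki.
Qed.

End Divisors.

Lemma mcoeffXM (R : nzRingType) n (m k : 'X_{1..n}) (p : {mpoly R[n]}) :
  ('X_[m] * p)@_k = if (m <= k)%MM then p@_(k - m) else 0.
Proof.
rewrite -commr_mpolyX.
case: ifP => [le_mk|nle]; first by rewrite -{1}(submK le_mk) addmC mcoeffMX.
apply: memN_msupp_eq0; rewrite (perm_mem (msuppMX p m)).
by apply: contraFN nle => /mapP[m' _ ->]; exact: lem_addr.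
Qed.

(** * The fine grading: from divisor complexes back to Koszul cohomology *)

Section Slices.

Variables (K : fieldType) (n : nat) (V : 'I_n -> vectType K).
Variables (d : 'I_n -> nat) (b : 'I_n -> int).

Local Notation I := (Lmon d V).
Local Notation N := (nsvar V).
Local Notation chain := (wedge_tensor I K^o).
Local Notation cochain q := (wedge_tensor I (sec V (twist d b q))).

(* The component of degree [alpha] in the fine grading by monomials.          *)
Definition slice q (alpha : 'X_{1..N}) (c : cochain q) : chain :=
  [ffun S : {set I} => if (weight S <= alpha)%MM
    then (mpoly_of_sec (c S))@_(alpha - weight S) else 0].

Lemma slice_inj q (c c' : cochain q) :
  (forall alpha, slice alpha c = slice alpha c') -> c = c'.
Proof.
move=> eq_cc'; apply/ffunP => S; apply/val_inj/mpolyP => m.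
have /ffunP/(_ S) := eq_cc' (weight S + m)%MM.
by rewrite !ffunE lem_addr addmC addmK.
Qed.

(** The differential moves a monomial from the wedge factor into the coefficient, so the total
    exponent alpha is preserved. *)
Lemma slice_koszul_diff q q' (hq : q' = q + 1) alpha (c : cochain q) :
  slice alpha (koszul_diff (fun v => Lmul hq v : {linear _ -> _}) c)
    = boundary (slice alpha c).
Proof.
apply/ffunP => T; rewrite [RHS]boundaryE ffunE /koszul_diff lfunE /= ffunE.
case: ifPn => [le_T|nle_T]; last first.
  rewrite big1 // => v vT; rewrite ffunE ifN ?mulr0 //.
  apply: contraNN nle_T; apply: lepm_trans.
  by rewrite weightU1 // lem_addl.
rewrite !raddf_sum /=; apply: eq_bigr => v vT.
rewrite mcoeffZ; congr (_ * _); rewrite mcoeffXM ffunE weightU1 //.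
have -> : (mon_of_smon v <= alpha - weight T)%MM
    = (mon_of_smon v + weight T <= alpha)%MM.
  apply/mnm_lepP/mnm_lepP => le_v t; move: (le_v t) (mnm_lepP le_T t);
    by rewrite mnmBE mnmDE; lia.
case: ifP => // _; congr (_ @_ _); apply/mnmP => t.
by rewrite !mnmBE mnmDE; lia.
Qed.

(** Each coefficient is read from exactly one alpha, so fillings chosen independently for each alpha
    glue. *)
Definition assemble q (f : 'X_{1..N} -> chain) : cochain q :=
  [ffun S : {set I} => \sum_(u : smon V (twist d b q))
    (f (mon_of_smon u + weight S)%MM S : K) *: secX u].

Lemma slice_assemble q (f : 'X_{1..N} -> chain) alpha :
    supported (fun S => (weight S <= alpha)%MM
      && has_multideg (twist d b q) (alpha - weight S)%MM) (f alpha) ->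
  slice alpha (assemble q f) = f alpha.
Proof.
move=> /supportedP supp_f; apply/ffunP => S; rewrite !ffunE.
have [f0|/supp_f/andP[le_S deg_S]] := eqVneq (f alpha S) 0; last first.
  have [u eq_u] := smon_surj deg_S.
  rewrite le_S raddf_sum raddf_sum /= (bigD1 u) //= big1 ?addr0 => [|u' ne_u'].
    by rewrite mcoeffZ mcoeffX -eq_u eqxx mulr1 eq_u submK.
  rewrite mcoeffZ mcoeffX -eq_u; case: eqP => [/mon_of_smon_inj eq_uu'|].
    by rewrite eq_uu' eqxx in ne_u'.
  by rewrite mulr0.
rewrite f0; case: ifP => // le_S; rewrite raddf_sum raddf_sum big1 // => u _ /=.
rewrite mcoeffZ mcoeffX; case: eqP => [->|_]; last by rewrite mulr0.
by rewrite submK // f0 mul0r.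
Qed.

Lemma koszul_cohomology2_eq0 p :
  (forall i, p%:Z <= (d i)%:Z + b i) -> koszul_cohomology d b V p 2 = 0%VS.
Proof.
move=> le_p; apply/eqP; rewrite koszul_homology_eq0; apply/subvP => c.
rewrite memv_cap memv_ker => /andP[/eqP cyc_c /wedge_powP pow_c].
pose good alpha (f : chain) :=
  supported (faces p.+1 (fun S => (weight S <= alpha)%MM
      && has_multideg (twist d b (2 - 1)) (alpha - weight S)%MM)) f
    && (boundary f == slice alpha c).
have ex_good alpha : exists f, good alpha f.
  (* Only a nonzero slice determines the multidegree of alpha; a zero slice is filled by 0. *)
  have [/existsP[S]|/existsPn slice0] := boolP [exists S, slice alpha c S != 0];
      last first.
    exists 0; rewrite /good supported0 linear0 /= eq_sym; apply/eqP/ffunP => S.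
    by rewrite [RHS]ffunE; apply/eqP/negPn/slice0.
  rewrite ffunE; case: ifP => [le_S ne_c|]; last by rewrite eqxx.
  have /forallP deg_S := multihomogP _ _ (sec_multihomog (c S)) _ ne_c.
  have card_S : #|S| = p.
    by apply: pow_c; apply: contraNneq ne_c => ->; rewrite mcoeff0.
  have deg_alpha j : (multideg alpha j)%:Z = twist d b 2 j + (p * d j)%:Z.
    rewrite -(eqP (deg_S j)) -PoszD -card_S -multideg_weight -multidegD.
    by rewrite submK.
  have fill_alpha : fills p (divides (d := d) alpha 0%MM).
    apply: fills_divides => j; have := deg_alpha j; have := le_p j.
    by rewrite multideg0 /twist; lia.
  have supp_c : supported (faces p (divides alpha 0%MM)) (slice alpha c).
    apply/supportedP => T; rewrite ffunE.
    case: ifP => [le_T ne_T|]; last by rewrite eqxx.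
    rewrite /faces /divides add0m le_T andbT; apply/eqP/pow_c.
    by apply: contraNneq ne_T => ->; rewrite mcoeff0.
  have bd_c : boundary (slice alpha c) = 0.
    rewrite -(slice_koszul_diff (erefl (2 + 1))) cyc_c.
    by apply/ffunP => T; rewrite !ffunE mcoeff0 if_same.
  have [f /supportedP supp_f bd_f] := fill_alpha _ supp_c bd_c.
  exists f; rewrite /good bd_f eqxx andbT; apply/supportedP => T.
  move=> /supp_f/andP[/eqP card_T]; rewrite /divides add0m => le_T.
  rewrite /faces card_T eqxx le_T /=; apply/forallP => j; apply/eqP.
  (* Removing (p + 1) d_j from b_j + (p + 2) d_j leaves b_j + d_j, the degree of the source term. *)
  have := deg_alpha j; rewrite -{1}(submK le_T) multidegD multideg_weight.
  by rewrite card_T /twist; lia.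
pose f alpha := xchoose (ex_good alpha).
have good_f alpha : good alpha (f alpha) := xchooseP (ex_good alpha).
have slice_f alpha : slice alpha (assemble (2 - 1) f) = f alpha.
  apply: slice_assemble; have /andP[supp_f _] := good_f alpha.
  by apply: sub_supported supp_f => S /andP[].
have <- : koszul_diff (fun v => Lmul (esym (subrK 1 2)) v : {linear _ -> _})
    (assemble (2 - 1) f) = c.
  apply: slice_inj => alpha; rewrite slice_koszul_diff slice_f.
  by have /andP[_ /eqP] := good_f alpha.
apply/memv_img/wedge_powP => S; apply: contraNeq => ne_p.
rewrite ffunE big1 // => u _.
have /andP[/supportedP supp_f _] := good_f (mon_of_smon u + weight S)%MM.
have [->|/supp_f/andP[]] := eqVneq (f (mon_of_smon u + weight S)%MM S) 0.
  by rewrite scale0r.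
by rewrite (negPf ne_p).
Qed.

End Slices.

Theorem corollary2p3 (K : fieldType) (charK : [pchar K] =i pred0)
    (n : nat) (d : 'I_n.+1 -> nat) (b : 'I_n.+1 -> int) (p : nat)
    (d_gt0 : forall i, (0 < d i)%N)
    (p_le : p%:Z <= \big[Num.min/(d ord0)%:Z + b ord0]_i ((d i)%:Z + b i))
    (V : 'I_n.+1 -> vectType K) :
  \dim {: koszul_functor d b p 2 V} = 0%N.
Proof.
have le_p i : p%:Z <= (d i)%:Z + b i := le_trans p_le (bigmin_le _ _ _).
rewrite /koszul_functor (koszul_cohomology2_eq0 _ le_p).
by rewrite dimvf; exact: dimv0.
Qed.
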